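(* Let $n\ge 1$, let $A,B,X\in\mathbb{M}_n$, and suppose that the block matrix $\begin{bmatrix} A & X\\ X^* & B\end{bmatrix}\in\mathbb{M}_{2n}$ is positive. Then, for all $j\in\{0,1,\ldots,n-1\}$, $$ \lambda_{1+2j}\left(\begin{bmatrix} A & X\\ X^* & B\end{bmatrix}\right)\le \lambda_{1+j}(A+B)+\delta_2(X). $$
   Context: $\mathbb{M}_n$ is the space of $n\times n$ complex matrices, viewed as operators on $\mathbb{C}^n$; ''positive'' means positive semidefinite (Hermitian). For a Hermitian matrix $S\in\mathbb{M}_d$, $\lambda_1(S)\ge\cdots\ge\lambda_d(S)$ denote its eigenvalues in decreasing order, counted with multiplicity. $W(X)=\{h^*Xh : h\in\mathbb{C}^n,\ \|h\|=1\}$ is the numerical range of $X$, a compact convex subset of $\mathbb{C}$. For a compact convex set $\Lambda\subset\mathbb{C}$, its indiameter $\delta(\Lambda)$ is the diameter of the largest possible disc contained in $\Lambda$ (so it is $0$ if $\Lambda$ is a point or a line segment), and $\delta(X):=\delta(W(X))$. For a subspace $\mathcal{S}\subset\mathbb{C}^n$, $X_{\mathcal{S}}$ denotes the compression of $X$ onto $\mathcal{S}$ (the operator $P X|_{\mathcal{S}}$ on $\mathcal{S}$, with $P$ the orthogonal projection onto $\mathcal{S}$). The elliptical width of $X$ is $$\delta_2(X):=\sup_{\dim\mathcal{S}=2}\delta(X_{\mathcal{S}}),$$ the supremum being over all two-dimensional subspaces $\mathcal{S}$ of $\mathbb{C}^n$; if $n=1$ it is read as $0$. *)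

(* Defs.v *)
(* The field of complex numbers is R[i], for an arbitrary R : realType. *)
From mathcomp Require Import all_boot all_order all_algebra.
From mathcomp Require Import complex classical_sets reals.

Set Implicit Arguments.
Unset Strict Implicit.
Unset Printing Implicit Defensive.

Import Order.TTheory GRing.Theory Num.Theory.
Local Open Scope ring_scope.
Local Open Scope classical_set_scope.
Local Open Scope complex_scope.
Local Open Scope sesquilinear_scope.

(* Conjugate-linear in the first argument. *)
Definition cdot (R : realType) (n : nat) (h k : 'cV[R[i]]_n) : R[i] :=
  (h ^t* *m k) 0 0.

Definition possemidef (R : realType) (n : nat) (M : 'M[R[i]]_n) : Prop :=
  M \is hermsymmx /\ forall h : 'cV[R[i]]_n, 0 <= cdot h (M *m h).

(* The roots of the characteristic polynomial, repeated according to their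
   multiplicity, in decreasing order. Taking real parts only serves to land in
   R: this is meant for Hermitian matrices, whose eigenvalues are real. *)
Definition eigenvals (R : realType) (n : nat) (M : 'M[R[i]]_n) : seq R :=
  sort >=%R
    [seq complex.Re z | z <- sval (closed_field_poly_normal (char_poly M))].

(* k is 1-based: lambda 1 M is the largest eigenvalue. *)
Definition lambda (R : realType) (n : nat) (k : nat) (M : 'M[R[i]]_n) : R :=
  nth 0 (eigenvals M) k.-1.

(* The numerical range of T viewed as an operator on the subspace S; W(X) is
   numrange fullv X. *)
Definition numrange (R : realType) (n : nat) (S : {vspace 'cV[R[i]]_n})
    (T : 'M[R[i]]_n) : set R[i] :=
  [set z | exists h, [/\ h \in S, cdot h h = 1 & z = cdot h (T *m h)]].

Definition cdisc (R : realType) (c : R[i]) (r : R) : set R[i] :=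
  [set z | `|z - c| <= r%:C].

(* Radius 0 is allowed, so the value is 0 when L has empty interior. *)
Definition indiameter (R : realType) (L : set R[i]) : R :=
  sup [set d : R | exists (c : R[i]) (r : R),
    [/\ 0 <= r, cdisc c r `<=` L & d = 2 * r]].

Definition is_orthoproj (R : realType) (n : nat) (S : {vspace 'cV[R[i]]_n})
    (P : 'M[R[i]]_n) : Prop :=
  forall h, P *m h \in S /\ forall k, k \in S -> cdot k (h - P *m h) = 0.

(* sup over the empty set is 0, which gives the convention for n = 1. *)
Definition elliptical_width (R : realType) (n : nat) (X : 'M[R[i]]_n) : R :=
  sup [set d : R | exists (S : {vspace 'cV[R[i]]_n}) (P : 'M[R[i]]_n),
    [/\ \dim S = 2%N, is_orthoproj S P & d = indiameter (numrange S (P *m X))]].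

(* Main.v *)
(* Let T be the span of the eigenvectors of A + B with (1-based) index greater
   than j. The space T + T has codimension 2j, so it contains some z = (h, k) != 0
   in the span of the first 1 + 2j eigenvectors of M = [A, X; X^*, B]. It remains
   to bound z^* M z / |z|^2 from above. Let S be the span of h and k, and suppose
   that W(c X_S) lies in the strip a <= Re <= b for some |c| = 1. In the orthogonal
   decomposition z = (u, cu) + (v, -cv), the diagonal blocks of M are
   (A + B) / 2 + Re(cX) and (A + B) / 2 - Re(cX), and a positive block matrix is
   bounded by the sum of the bounds of its diagonal blocks, here
   lambda (1 + j) (A + B) + b - a.

   Finally W(X_S) is an ellipse, whose narrowest enclosing strip is as wide as its
   largest disc. The phase c is chosen to align the axes of the ellipse: writing
   the traceless part of c X_S as H + iK, it makes tr(HK) = 0 and tr H^2 <= tr K^2,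
   so that in an eigenbasis of H the strip and the disc can be read off. *)
Require Import Defs.
From mathcomp Require Import all_boot all_order all_algebra.
From mathcomp Require Import complex boolp classical_sets reals ring lra.

Import Order.TTheory GRing.Theory Num.Theory.
Local Open Scope ring_scope.
Local Open Scope complex_scope.
Local Open Scope sesquilinear_scope.

Set Implicit Arguments.
Unset Strict Implicit.

Local Notation Re := (@complex.Re _).
Local Notation Im := (@complex.Im _).

(** * Real and imaginary parts *)

Section ComplexParts.
Context {R : realType}.
Implicit Types x y z : R[i].

Lemma cReD x y : Re (x + y) = Re x + Re y. Proof. by case: x; case: y. Qed.
Lemma cImD x y : Im (x + y) = Im x + Im y. Proof. by case: x; case: y. Qed.
Lemma cReN x : Re (- x) = - Re x. Proof. by case: x. Qed.
Lemma cImN x : Im (- x) = - Im x. Proof. by case: x. Qed.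
Lemma cReM x y : Re (x * y) = Re x * Re y - Im x * Im y.
Proof. by case: x; case: y. Qed.
Lemma cImM x y : Im (x * y) = Re x * Im y + Im x * Re y.
Proof. by case: x; case: y. Qed.
Lemma cReJ x : Re (Num.conj x) = Re x. Proof. by case: x. Qed.
Lemma cImJ x : Im (Num.conj x) = - Im x. Proof. by case: x. Qed.

Definition ReImE := (cReD, cImD, cReN, cImN, cReM, cImM, cReJ, cImJ).

Lemma cRe_sum (I : finType) (F : I -> R[i]) : Re (\sum_i F i) = \sum_i Re (F i).
Proof. exact: (big_morph _ cReD). Qed.

Lemma complex_ReIm x y : Re x = Re y -> Im x = Im y -> x = y.
Proof. by case: x; case: y => ? ? ? ? /= -> ->. Qed.

Lemma mulJ_normsq z : Num.conj z * z = (Re z ^+ 2 + Im z ^+ 2)%:C.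
Proof. by apply: complex_ReIm; rewrite !ReImE /=; ring. Qed.

End ComplexParts.

(** * Inner product and quadratic forms *)

Section InnerProduct.
Context {R : realType}.

Lemma cdotE {n} (h k : 'cV[R[i]]_n) :
  cdot h k = \sum_i Num.conj (h i 0) * k i 0.
Proof. by rewrite /cdot mxE; apply: eq_bigr => i _; rewrite !mxE. Qed.

Lemma cdotDl {n} (h h' k : 'cV[R[i]]_n) : cdot (h + h') k = cdot h k + cdot h' k.
Proof. by rewrite /cdot linearD /= map_mxD mulmxDl mxE. Qed.
Lemma cdotDr {n} (h k k' : 'cV[R[i]]_n) : cdot h (k + k') = cdot h k + cdot h k'.
Proof. by rewrite /cdot mulmxDr mxE. Qed.
Lemma cdotNl {n} (h k : 'cV[R[i]]_n) : cdot (- h) k = - cdot h k.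
Proof. by rewrite /cdot linearN /= map_mxN mulNmx mxE. Qed.
Lemma cdotNr {n} (h k : 'cV[R[i]]_n) : cdot h (- k) = - cdot h k.
Proof. by rewrite /cdot mulmxN mxE. Qed.
Lemma cdotZl {n} a (h k : 'cV[R[i]]_n) : cdot (a *: h) k = Num.conj a * cdot h k.
Proof. by rewrite /cdot linearZ /= map_mxZ -scalemxAl mxE. Qed.
Lemma cdotZr {n} a (h k : 'cV[R[i]]_n) : cdot h (a *: k) = a * cdot h k.
Proof. by rewrite /cdot -scalemxAr mxE. Qed.

Definition cdotL := (@cdotDl, @cdotDr, @cdotNl, @cdotNr, @cdotZl, @cdotZr).

Lemma trmxC_mul {m n p} (A : 'M[R[i]]_(m, n)) (B : 'M[R[i]]_(n, p)) :
  (A *m B)^t* = B^t* *m A^t*.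
Proof. by rewrite trmx_mul map_mxM. Qed.

Lemma cdotC {n} (h k : 'cV[R[i]]_n) : cdot h k = Num.conj (cdot k h).
Proof.
rewrite !cdotE rmorph_sum; apply: eq_bigr => i _.
by rewrite rmorphM /= conjCK mulrC.
Qed.

Lemma cdot_mull {m n} (A : 'M[R[i]]_(m, n)) h k :
  cdot (A *m h) k = cdot h (A^t* *m k).
Proof. by rewrite /cdot trmxC_mul mulmxA. Qed.

Lemma cdot_isometry {m n} (U : 'M[R[i]]_(m, n)) h k :
  U^t* *m U = 1%:M -> cdot (U *m h) (U *m k) = cdot h k.
Proof. by move=> UU; rewrite cdot_mull mulmxA UU mul1mx. Qed.

Lemma cdot_col_mx {m n} (h h' : 'cV[R[i]]_m) (k k' : 'cV[R[i]]_n) :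
  cdot (col_mx h k) (col_mx h' k') = cdot h h' + cdot k k'.
Proof. by rewrite /cdot tr_col_mx map_row_mx mul_row_col mxE. Qed.

Definition normsq {n} (h : 'cV[R[i]]_n) : R := Re (cdot h h).
(** For a non-Hermitian [M] this is the form of its Hermitian part. *)
Definition qform {n} (M : 'M[R[i]]_n) (h : 'cV[R[i]]_n) : R := Re (cdot h (M *m h)).

Lemma normsqE {n} (h : 'cV[R[i]]_n) :
  normsq h = \sum_i (Re (h i 0) ^+ 2 + Im (h i 0) ^+ 2).
Proof.
by rewrite /normsq cdotE cRe_sum; apply: eq_bigr => i _; rewrite mulJ_normsq.
Qed.

Lemma cdot_normsq {n} (h : 'cV[R[i]]_n) : cdot h h = (normsq h)%:C.
Proof.
rewrite normsqE cdotE rmorph_sum; apply: eq_bigr => i _; exact: mulJ_normsq.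
Qed.

Lemma normsq_ge0 {n} (h : 'cV[R[i]]_n) : 0 <= normsq h.
Proof. by rewrite normsqE sumr_ge0 // => i _; rewrite addr_ge0 ?sqr_ge0. Qed.

Lemma normsq_gt0 {n} (h : 'cV[R[i]]_n) : h != 0 -> 0 < normsq h.
Proof.
move=> h0; rewrite lt_neqAle normsq_ge0 andbT eq_sym; apply: contraNneq h0.
rewrite normsqE => /eqP; rewrite psumr_eq0; last first.
  by move=> i _; rewrite addr_ge0 ?sqr_ge0.
move=> /allP h0; apply/eqP/colP => i; rewrite mxE.
have := h0 i (mem_index_enum i).
rewrite paddr_eq0 ?sqr_ge0 // !sqrf_eq0 => /andP[/eqP r0 /eqP i0].
exact: complex_ReIm.
Qed.

Lemma qformD {n} (M M' : 'M[R[i]]_n) h : qform (M + M') h = qform M h + qform M' h.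
Proof. by rewrite /qform mulmxDl cdotDr cReD. Qed.

Lemma qformDD {n} (M : 'M[R[i]]_n) x y (a b : R) : M^t* = M ->
  qform M (a%:C *: x + b%:C *: y) = a ^+ 2 * qform M x + b ^+ 2 * qform M y
    + 2 * a * b * Re (cdot x (M *m y)).
Proof.
move=> MM; rewrite /qform mulmxDr -!scalemxAr !cdotL (cdotC y) cdot_mull MM.
rewrite !ReImE /=; move: (cdot x _) (cdot x _) (cdot y _) => p q r.
move: (Re p) (Re q) (Re r) (Im p) (Im q) (Im r) => *; ring.
Qed.

Lemma hermsymmxE {n} (M : 'M[R[i]]_n) : M \is hermsymmx -> M^t* = M.
Proof. by move=> /is_hermitianmxP; rewrite expr0 scale1r => <-. Qed.

Lemma possemidef_ge0 {n} {M : 'M[R[i]]_n} h : possemidef M -> 0 <= qform M h.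
Proof. by case=> _ /(_ h); rewrite lecE => /andP[]. Qed.

End InnerProduct.

(** * Upper bounds for the form of a positive block matrix *)

Section BlockMatrix.
Context {R : realType}.

Lemma normsqD {n} (x y : 'cV[R[i]]_n) :
  normsq (x + y) = normsq x + normsq y + 2 * Re (cdot x y).
Proof. rewrite /normsq !cdotL (cdotC y) !cReD cReJ.
by move: (Re _) (Re _) (Re _) => *; ring. Qed.

Lemma normsqN {n} (x : 'cV[R[i]]_n) : normsq (- x) = normsq x.
Proof. by rewrite /normsq !cdotL opprK. Qed.

Lemma unitary_normsqZ {n} (c : R[i]) (x : 'cV[R[i]]_n) :
  Num.conj c * c = 1 -> normsq (c *: x) = normsq x.
Proof. by move=> cc; rewrite /normsq !cdotL mulrA cc mul1r. Qed.

Lemma normsq_col_mx {m n} (h : 'cV[R[i]]_m) (k : 'cV[R[i]]_n) :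
  normsq (col_mx h k) = normsq h + normsq k.
Proof. by rewrite /normsq cdot_col_mx cReD. Qed.

Lemma qform_block {n} (A B X : 'M[R[i]]_n) h k :
  qform (block_mx A X (X ^t*) B) (col_mx h k)
    = qform A h + qform B k + 2 * Re (cdot h (X *m k)).
Proof.
rewrite /qform mul_block_col cdot_col_mx !cdotL -(cdot_mull X k h) (cdotC (X *m k)).
rewrite !cReD cReJ -/(qform A h) -/(qform B k).
by move: (qform _ _) (qform _ _) (Re _) => *; ring.
Qed.

(** With [c] and [- c] these are the two diagonal blocks, up to the factor 2 between the squared
    norms of [(u, cu)] and [u]. *)
Lemma qform_block_diag {n} (A B X : 'M[R[i]]_n) u (c : R[i]) :
  Num.conj c * c = 1 ->
  qform (block_mx A X (X ^t*) B) (col_mx u (c *: u))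
    = qform (A + B) u + 2 * Re (c * cdot u (X *m u)).
Proof.
move=> cc; rewrite qform_block qformD {2}/qform -!scalemxAr !cdotL mulrA cc mul1r.
by rewrite -/(qform B u).
Qed.

(** [p * q] times the gap in the conclusion is the sum of three nonnegative terms: the one in the
    last hypothesis and the two products below. *)
Lemma cross_term_bound (p q r s a b t : R) :
  0 < p -> 0 < q -> a <= p * r -> b <= q * s ->
  0 <= q ^+ 2 * a + p ^+ 2 * b - 2 * q * p * t ->
  a + b + 2 * t <= (p + q) * (r + s).
Proof.
move=> p0 q0 ar bs cross; rewrite -(ler_pM2l (mulr_gt0 p0 q0)).
have pq0 : 0 <= p + q by rewrite addr_ge0 ?ltW.
have : 0 <= q * (p + q) * (p * r - a) by rewrite !mulr_ge0 ?subr_ge0 // ltW.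
have : 0 <= p * (p + q) * (q * s - b) by rewrite !mulr_ge0 ?subr_ge0 // ltW.
by move: cross; nra.
Qed.

(* Positivity at [q x - p y] bounds the cross term of [M] at [x + y]. *)
Lemma qform_sum_le {n} (M : 'M[R[i]]_n) x y (p q r s : R) :
  possemidef M -> 0 <= p -> 0 <= q -> 0 <= r -> 0 <= s ->
  qform M x <= p * r -> qform M y <= q * s ->
  qform M (x + y) <= (p + q) * (r + s).
Proof.
move=> M_ge0 p0 q0 r0 s0 Mx My; have MM := hermsymmxE (proj1 M_ge0).
(* [cross_term_bound] cancels the factor [p * q], so [p] and [q] are first enlarged by [d > 0]; then
   [d] tends to 0. *)
have pos d : 0 < d -> qform M (x + y) <= (p + d + (q + d)) * (r + s).
  move=> d0; have := possemidef_ge0 ((q + d)%:C *: x + (- (p + d))%:C *: y) M_ge0.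
  have := qformDD x y 1 1 MM; rewrite !scale1r expr1n !mul1r !mulr1 => ->.
  rewrite qformDD // sqrrN mulrN mulNr.
  apply: cross_term_bound; rewrite ?ltr_wpDl //.
    by apply: le_trans Mx _; rewrite ler_wpM2r // lerDl ltW.
  by apply: le_trans My _; rewrite ler_wpM2r // lerDl ltW.
move: pos; move: (qform _ _) => m pos.
apply/ler_addgt0Pr => e e0.
(* The enlargement costs [2 * d * (r + s)], which the next choice of [d] keeps below [e]; the added
   1 avoids a division by 0. *)
have rs : 0 < 2 * (r + s + 1) by rewrite mulr_gt0 // ltr_wpDl // addr_ge0.
have d0 : 0 < e / (2 * (r + s + 1)) by rewrite divr_gt0.
apply: (le_trans (pos _ d0)).
have : e / (2 * (r + s + 1)) * (2 * (r + s + 1)) = e by rewrite divfK // gt_eqF.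
move: d0 {pos e0 rs Mx My p0 q0 r0 s0 M_ge0 MM}; move: (e / _) => d.
by lra.
Qed.

Lemma qform_block_le {n} (A B X : 'M[R[i]]_n) (c : R[i]) (mu a b : R)
    (h k : 'cV[R[i]]_n) :
  possemidef (block_mx A X (X ^t*) B) -> Num.conj c * c = 1 ->
  (forall s t, let w := s *: h + t *: k in
    [/\ qform (A + B) w <= mu * normsq w,
        a * normsq w <= Re (c * cdot w (X *m w)) &
        Re (c * cdot w (X *m w)) <= b * normsq w]) ->
  qform (block_mx A X (X ^t*) B) (col_mx h k)
    <= (mu + (b - a)) * normsq (col_mx h k).
Proof.
set M := block_mx _ _ _ _ => M_ge0 cc span_le.
have cN : Num.conj (- c) * (- c) = 1 by rewrite rmorphN mulrNN.
have diag_le s t : let w := s *: h + t *: k in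
    qform M (col_mx w (c *: w)) <= (mu + 2 * b) * normsq w /\
    qform M (col_mx w (- c *: w)) <= (mu - 2 * a) * normsq w.
  move=> w; have [AB Xa Xb] := span_le s t; rewrite !qform_block_diag //.
  rewrite mulNr cReN; rewrite -/w in AB Xa Xb *.
  move: AB Xa Xb; move: (qform _ _) (Re _) (normsq w) => q x N *; split; lra.
have [/eqP|zn0] := eqVneq (col_mx h k) 0.
  rewrite col_mx_eq0 => /andP[/eqP-> /eqP->].
  by rewrite col_mx0 /qform /normsq mulmx0 /cdot mulmx0 mxE mulr0.
(* [qform_sum_le] wants nonnegative bounds. Positivity of [M] at [(w, cw)] and [(w, -cw)] gives them
   for any nonzero [w] in the span, and one exists because [(h, k)] is nonzero. *)
have [pge qge] : 0 <= mu + 2 * b /\ 0 <= mu - 2 * a.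
  have [s [t wn0]] : exists s t, s *: h + t *: k != 0.
    case: (eqVneq h 0) zn0 => [-> | h0 _].
      rewrite col_mx_eq0 eqxx /= => k0.
      by exists 0, 1; rewrite scaler0 add0r scale1r.
    by exists 1, 0; rewrite scale0r addr0 scale1r.
  have n0 := normsq_gt0 wn0; have [] := diag_le s t.
  set w := s *: h + t *: k in wn0 n0 * => le1 le2.
  split; rewrite -(pmulr_lge0 _ n0).
    by apply: le_trans le1; apply: possemidef_ge0.
  by apply: le_trans le2; apply: possemidef_ge0.
(* The solution of [h = u + v], [k = c (u - v)]; both vectors lie in the span of [h] and [k], where
   the hypotheses apply. *)
pose u := 2^-1 *: h + (2^-1 * Num.conj c) *: k.
pose v := 2^-1 *: h - (2^-1 * Num.conj c) *: k.
have half2 : 2^-1 + 2^-1 = 1 :> R[i] by field.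
have hE : h = u + v.
  by rewrite /u /v addrACA subrr addr0 -scalerDl half2 scale1r.
have kE : k = c *: (u - v).
  rewrite /u /v opprD addrACA opprK subrr add0r.
  by rewrite -scalerDl scalerA -mulrDl half2 mul1r mulrC cc scale1r.
(* This factor 2 absorbs the one in [2 * mu + 2 * b - 2 * a], the sum of the two bounds. *)
have Nz : normsq (col_mx h k) = 2 * (normsq u + normsq v).
  rewrite normsq_col_mx hE kE unitary_normsqZ // (normsqD u v) (normsqD u (- v)).
  rewrite normsqN cdotNr cReN.
  by move: (normsq u) (normsq v) (Re _) => *; ring.
have -> : col_mx h k = col_mx u (c *: u) + col_mx v (- c *: v).
  by rewrite add_col_mx -hE scaleNr -scalerBr -kE.
have [ule _] := diag_le 2^-1 (2^-1 * Num.conj c).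
have [_ ] := diag_le 2^-1 (- (2^-1 * Num.conj c)); rewrite scaleNr => vle.
have := qform_sum_le M_ge0 pge qge (normsq_ge0 _) (normsq_ge0 _) ule vle.
move=> /le_trans; apply; rewrite add_col_mx -hE scaleNr -scalerBr -kE Nz.
rewrite -/u -/v le_eqVlt; apply/orP; left; apply/eqP.
by move: (normsq u) (normsq v) => *; ring.
Qed.

End BlockMatrix.

(** * Eigenvalues of Hermitian matrices and their extremal properties *)

Lemma char_poly_similar {F : fieldType} {n} (V A B : 'M[F]_n) :
  V \in unitmx -> V *m A = B *m V -> char_poly A = char_poly B.
Proof.
move=> Vu VA; have detV : \det (map_mx (@polyC F) V) != 0.
  by rewrite det_map_mx /= polyC_eq0 -unitfE -unitmxE.
apply: (mulfI detV); rewrite -det_mulmx [RHS]mulrC -det_mulmx.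
rewrite /char_poly_mx mulmxBl mulmxBr -!map_mxM VA.
by rewrite mul_mx_scalar mul_scalar_mx.
Qed.

Section SortedCount.
Context {R : realType}.
Variables (s : seq R) (k : nat).
Hypotheses (s_sorted : sorted >=%R s) (k_lt : (k < size s)%N).

Let nth_ge i j : (i <= j)%N -> (j < size s)%N -> nth 0 s j <= nth 0 s i.
Proof.
move=> ij js; apply: (sorted_leq_nth _ _ 0 s_sorted) => //.
- by move=> x y z /= yx /le_trans; apply.
- exact: lexx.
- exact: leq_ltn_trans js.
Qed.

(** The strict comparison leaves out ties with the entry at [k], so only earlier positions can
    count. *)
Lemma count_gt_nth : (count (> nth 0 s k)%R s <= k)%N.
Proof.
rewrite -[X in count _ X](cat_take_drop k) count_cat.
have -> : count (> nth 0 s k) (drop k s) = 0%N.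
  apply/eqP; rewrite -leqn0 leqNgt -has_count; apply/hasPn => x; case/(nthP 0) => i.
  rewrite size_drop nth_drop => il <-; rewrite -leNgt nth_ge ?leq_addr //.
  by rewrite -ltn_subRL.
by rewrite addn0 (leq_trans (count_size _ _)) // size_take k_lt.
Qed.

Lemma count_lt_nth : (count (< nth 0 s k)%R s <= size s - k.+1)%N.
Proof.
rewrite -[X in count _ X](cat_take_drop k.+1) count_cat.
have -> : count (< nth 0 s k) (take k.+1 s) = 0%N.
  apply/eqP; rewrite -leqn0 leqNgt -has_count; apply/hasPn => x; case/(nthP 0) => i.
  by rewrite size_takel // => il <-; rewrite nth_take // -leNgt nth_ge.
by rewrite add0n (leq_trans (count_size _ _)) // size_drop.
Qed.

End SortedCount.

Section Spectrum.
Context {R : realType}.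

(** The rows of [V] are conjugated eigenvectors. The order of [d] comes from the spectral theorem
    and need not be decreasing, hence a permutation instead of an equality. *)
Lemma hermitian_eigenbasis {n} (M : 'M[R[i]]_n) : M \is hermsymmx ->
  exists (V : 'M[R[i]]_n) (d : 'I_n -> R),
    [/\ V^t* *m V = 1%:M, V *m M = diag_mx (\row_i (d i)%:C) *m V &
        perm_eq (eigenvals M) [seq d i | i <- enum 'I_n]].
Proof.
move=> Mh; pose V := spectralmx M; pose d i := Re (spectral_diag M 0 i).
have Vu : V \is unitarymx := spectral_unitarymx M.
have dE : \row_i (d i)%:C = spectral_diag M.
  apply/rowP => i; rewrite mxE RRe_real //.
  by have /mxOverP := hermitian_spectral_diag_real Mh; apply.
have VV : V^t* *m V = 1%:M by rewrite -invmx_unitary // mulVmx ?unitarymx_unit.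
have VM : V *m M = diag_mx (\row_i (d i)%:C) *m V.
  have /orthomx_spectralP ME := hermitian_normalmx Mh.
  by rewrite [X in V *m X]ME -mulmxA (mulKVmx (spectral_unit M)) dE.
exists V, d; split=> //.
rewrite /eigenvals perm_sort.
case: closed_field_poly_normal => r /=; rewrite (monicP (char_poly_monic M)) scale1r.
rewrite (char_poly_similar (unitarymx_unit Vu) VM) char_poly_trig; last first.
  by apply: diag_mx_is_trig.
(* Both lists are the roots of the same monic polynomial, so unique factorisation matches them. *)
move=> cp; have : perm_eq r [seq (d i)%:C | i <- enum 'I_n].
  apply: prod_XsubC_eq; rewrite -cp big_map big_enum /=.
  by apply: eq_bigr => i _; rewrite !mxE eqxx mulr1n.
by move=> /(perm_map (fun z => Re z)); rewrite -map_comp.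
Qed.

Section Coordinates.
Variables (n : nat) (M V : 'M[R[i]]_n) (d : 'I_n -> R).
Hypotheses (VV : V^t* *m V = 1%:M)
  (VM : V *m M = diag_mx (\row_i (d i)%:C) *m V).

Lemma qform_coord h :
  qform M h = \sum_i d i * (Re ((V *m h) i 0) ^+ 2 + Im ((V *m h) i 0) ^+ 2).
Proof.
rewrite /qform -(cdot_isometry _ _ VV) (mulmxA V) VM -mulmxA cdotE cRe_sum.
apply: eq_bigr => i _; rewrite mul_diag_mx !mxE mulrCA cReM mulJ_normsq /=.
by ring.
Qed.

Lemma normsq_coord h :
  normsq h = \sum_i (Re ((V *m h) i 0) ^+ 2 + Im ((V *m h) i 0) ^+ 2).
Proof. by rewrite -normsqE /normsq cdot_isometry. Qed.

Lemma qform_coord_le mu h :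
  (forall i, mu < d i -> (V *m h) i 0 = 0) -> qform M h <= mu * normsq h.
Proof.
move=> h0; rewrite qform_coord normsq_coord mulr_sumr ler_sum // => i _.
have [le_d|/h0->] := leP (d i) mu; last by rewrite /= expr0n addr0 !mulr0.
by rewrite ler_wpM2r // addr_ge0 ?sqr_ge0.
Qed.

Lemma qform_coord_ge mu h :
  (forall i, d i < mu -> (V *m h) i 0 = 0) -> mu * normsq h <= qform M h.
Proof.
move=> h0; rewrite qform_coord normsq_coord mulr_sumr ler_sum // => i _.
have [le_d|/h0->] := leP mu (d i); last by rewrite /= expr0n addr0 !mulr0.
by rewrite ler_wpM2r // addr_ge0 ?sqr_ge0.
Qed.

End Coordinates.

(** The two halves of the Courant-Fischer principle: [P] and [Q] select the eigenvectors whose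
    eigenvalue is above, respectively below, the given one. Their sizes count linear conditions on
    [h]. Here [k] is 0-based. *)
Lemma hermitian_lambda {n} (M : 'M[R[i]]_n) k : M \is hermsymmx -> (k < n)%N ->
  exists (V : 'M[R[i]]_n) (P Q : pred 'I_n),
    [/\ (#|P| <= k)%N, (#|Q| <= n - k.+1)%N,
      forall h, (forall i, P i -> (V *m h) i 0 = 0) ->
        qform M h <= lambda k.+1 M * normsq h &
      forall h, (forall i, Q i -> (V *m h) i 0 = 0) ->
        lambda k.+1 M * normsq h <= qform M h].
Proof.
move=> Mh kn; have [V [d [VV VM /permP eig]]] := hermitian_eigenbasis Mh.
have countE (a : pred R) : count a (eigenvals M) = #|[pred i | a (d i)]|.
  rewrite eig count_map -size_filter cardE {1}enumT.
  by congr size; apply: eq_filter => i; rewrite inE.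
have size_eig : size (eigenvals M) = n.
  by rewrite -count_predT countE cardT size_enum_ord.
have sorted_eig : sorted >=%R (eigenvals M).
  by apply: sort_sorted => x y; exact: le_total.
exists V, [pred i | lambda k.+1 M < d i], [pred i | d i < lambda k.+1 M].
split.
- rewrite -(countE (fun x => lambda k.+1 M < x)).
  by apply: count_gt_nth; rewrite ?size_eig.
- rewrite -(countE (fun x => x < lambda k.+1 M)).
  rewrite -[X in (X - _)%N]size_eig.
  by apply: count_lt_nth; rewrite ?size_eig.
- by move=> h; apply: (qform_coord_le VV VM).
- by move=> h; apply: (qform_coord_ge VV VM).
Qed.

End Spectrum.

(** Fewer equations than unknowns: the matrix of the selected forms has rank below [m]. *)
Lemma exists_common_zero {F : fieldType} {I : finType} {m} (f : I -> 'rV[F]_m)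
    (P : pred I) : (#|P| < m)%N ->
  exists2 z : 'cV[F]_m, z != 0 & forall i, P i -> f i *m z = 0.
Proof.
move=> Pm; pose K := \matrix_(i < #|P|) f (enum_val i).
have : kermx K^T != 0.
  by rewrite kermx_eq0 /row_free mxrank_tr neq_ltn (leq_ltn_trans (rank_leq_row _)).
case/rowV0Pn => v /sub_kermxP vK v0; exists v^T; first by rewrite trmx_eq0.
move=> i Pi; have := congr1 trmx vK; rewrite trmx_mul trmxK trmx0.
move=> /(congr1 (row (enum_rank_in Pi i))); rewrite row_mul row0 rowK.
by rewrite enum_rankK_in.
Qed.

(** * Bounds for the indiameter and the elliptical width *)

Section EllipticalWidth.
Context {R : realType}.
Local Open Scope classical_set_scope.

(** If [E] is empty or unbounded above, [sup] takes its default value 0. *)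
Lemma sup_ge0 (E : set R) : (forall x, E x -> 0 <= x) -> 0 <= sup E.
Proof.
move=> E0; have [[[x Ex] ubE]|/sup_out->//] := pselect (has_sup E).
exact: le_trans (E0 x Ex) (ub_le_sup ubE Ex).
Qed.

Lemma indiameter_ge0 (L : set R[i]) : 0 <= indiameter L.
Proof. by apply: sup_ge0 => _ [c [r [r0 _ ->]]]; rewrite mulr_ge0. Qed.

Lemma elliptical_width_ge0 {n} (X : 'M[R[i]]_n) : 0 <= elliptical_width X.
Proof. by apply: sup_ge0 => _ [S [P [_ _ ->]]]; apply: indiameter_ge0. Qed.

Section Strip.
Variables (L : set R[i]) (lo hi : R).
Hypothesis L_strip : forall z, L z -> lo <= Re z <= hi.

(** The disc contains [c + r] and [c - r], whose real parts differ by [2 * r]. *)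
Lemma disc_in_strip_le c r : 0 <= r -> cdisc c r `<=` L -> 2 * r <= hi - lo.
Proof.
move=> r0 cL.
have /L_strip/andP[_] : L (c + r%:C).
  by apply: cL; rewrite /cdisc /= addrC addKr ger0_norm ?ler0c.
have /L_strip/andP[+ _] : L (c - r%:C).
  by apply: cL; rewrite /cdisc /= addrC addKr normrN ger0_norm ?ler0c.
by rewrite !ReImE /=; lra.
Qed.

Lemma indiameter_le_strip : lo <= hi -> indiameter L <= hi - lo.
Proof.
move=> lohi; rewrite /indiameter; set E := (X in sup X).
have [E0|/nonemptyPn->] := pselect (E !=set0); last by rewrite sup0 subr_ge0.
by apply: ge_sup => // _ [c [r [r0 cL ->]]]; apply: disc_in_strip_le cL.
Qed.

(** Here the strip serves to bound the set of diameters; on an unbounded set [sup] would be 0. *)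
Lemma le_indiameter c r : 0 <= r -> cdisc c r `<=` L -> 2 * r <= indiameter L.
Proof.
move=> r0 cL; apply: ub_le_sup; last by exists c, r.
by exists (hi - lo) => _ [c' [r' [r'0 c'L ->]]]; apply: disc_in_strip_le c'L.
Qed.

End Strip.

(** The extreme eigenvalues of [X + X^*], halved, bound the form. The resulting strip contains the
    numerical range of every compression of [X], which makes the suprema behind [elliptical_width]
    finite. *)
Lemma qform_bounds {n} (X : 'M[R[i]]_n) : (0 < n)%N -> exists lo hi : R,
  lo <= hi /\ forall h, lo * normsq h <= qform X h <= hi * normsq h.
Proof.
move=> n0; pose H := X + X^t*.
have HH : H \is hermsymmx.
  apply/is_hermitianmxP; rewrite expr0 scale1r /H linearD /= map_mxD trmxCK.
  by rewrite addrC.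
have qH h : qform H h = 2 * qform X h.
  rewrite qformD /qform -cdot_mull cdotC cReJ; move: (Re _) => q; ring.
(* For the largest eigenvalue [P] is empty and for the smallest one [Q] is, so the bounds hold for
   every [h]. *)
have [V [P [_ [P0 _ HP _]]]] := hermitian_lambda HH n0.
have n1 : (n.-1 < n)%N by rewrite prednK.
have [W [_ [Q [_ Q0 _ HQ]]]] := hermitian_lambda HH n1.
pose lo := lambda n.-1.+1 H / 2; pose hi := lambda 1 H / 2.
have bounds h : lo * normsq h <= qform X h <= hi * normsq h.
  have: qform H h <= lambda 1 H * normsq h.
    apply: HP => i; have /pred0P/(_ i) /= -> // : pred0b P by rewrite /pred0b -leqn0.
  have: lambda n.-1.+1 H * normsq h <= qform H h.
    apply: HQ => i; have /pred0P/(_ i) /= -> // : pred0b Q.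
    by move: Q0; rewrite prednK // subnn leqn0.
  rewrite qH /lo /hi; move: (lambda _ _) (lambda _ _) => l l'.
  move: (normsq h) (qform X h) => N q.
  by move=> le1 le2; apply/andP; split; lra.
exists lo, hi; split=> //.
have h0 : const_mx 1 != 0 :> 'cV[R[i]]_n.
  apply/eqP => /colP/(_ (Ordinal n0)); rewrite !mxE => /eqP.
  by rewrite oner_eq0.
rewrite -(ler_pM2r (normsq_gt0 h0)).
by have /andP[] := bounds (const_mx 1); apply: le_trans.
Qed.

Lemma orthoproj_cdot {n} S (P : 'M[R[i]]_n) h k :
  is_orthoproj S P -> h \in S -> cdot h (P *m k) = cdot h k.
Proof.
move=> /(_ k)[_ orth] /orth; rewrite cdotDr cdotNr => /eqP.
by rewrite subr_eq0 => /eqP.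
Qed.

(** Replaces planes and their projections by isometries from C^2, so that only 2 x 2 matrices remain
    to be studied. *)
Lemma le_elliptical_width {n} (X : 'M[R[i]]_n) (U : 'M[R[i]]_(n, 2)) c (r : R) :
  (0 < n)%N -> U^t* *m U = 1%:M -> 0 <= r ->
  (forall z, `|z - c| <= r%:C ->
     exists2 v, cdot v v = 1 & z = cdot (U *m v) (X *m (U *m v))) ->
  2 * r <= elliptical_width X.
Proof.
move=> n0 UU r0 disc; have [lo [hi [lohi Xb]]] := qform_bounds X n0.
have strip S P : is_orthoproj S P ->
    forall z, numrange S (P *m X) z -> lo <= Re z <= hi.
  move=> SP z [h [hS hh ->]]; rewrite -mulmxA (orthoproj_cdot _ SP) //.
  by have := Xb h; rewrite /qform /normsq hh /= !mulr1.
pose e := [:: col 0 U; col 1 U]; pose S := <<e>>%VS.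
have colE (v : 'cV[R[i]]_2) : U *m v = v 0 0 *: col 0 U + v 1 0 *: col 1 U.
  apply/colP => i; rewrite !mxE !big_ord_recl big_ord0 addr0.
  by congr (_ + _); rewrite mulrC; congr (v _ _ * U _ _); apply: val_inj.
have US v : U *m v \in S.
  by rewrite colE memvD // memvZ // memv_span // !inE eqxx ?orbT.
have SU h : h \in S -> exists v, h = U *m v.
  rewrite /S span_cons span_seq1 => /memv_addP[_ /vlineP[a ->] [_ /vlineP[b ->] ->]].
  exists (\col_i [eta fun=> 0 with 0 |-> a, 1 |-> b] i).
  by rewrite colE !mxE.
(* The orthogonal projection onto the range of an isometry [U] is [U U^*]. *)
have SP : is_orthoproj S (U *m U^t*).
  move=> h; split; first by rewrite -mulmxA US.
  move=> k /SU[v ->]; rewrite cdotDr cdotNr !cdot_mull !mulmxA UU mul1mx.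
  by rewrite subrr.
(* A linear relation between the columns is a vector killed by [U], hence 0. *)
have Sdim : \dim S = 2%N.
  apply/eqP; rewrite -[2%N]/(size e) -/(free _).
  apply/freeP => a; rewrite !big_ord_recl big_ord0 addr0 /= => a0.
  pose v := \col_i a i.
  have Uv : U *m v = 0.
    by rewrite colE !mxE -[RHS]a0; congr (_ + a _ *: _); apply: val_inj.
  have v0 : v = 0 by rewrite -[v]mul1mx -UU -mulmxA Uv mulmx0.
  by move=> i; have := congr1 (fun u : 'cV_2 => u i 0) v0; rewrite !mxE.
have bnd : has_ubound [set d : R |
    exists (S : {vspace 'cV[R[i]]_n}) (P : 'M[R[i]]_n),
    [/\ \dim S = 2%N, is_orthoproj S P & d = indiameter (numrange S (P *m X))]].
  exists (hi - lo) => _ [S' [P' [_ SP' ->]]].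
  exact: indiameter_le_strip (strip _ _ SP') lohi.
apply: (le_trans _ (ub_le_sup bnd _)); last by exists S, (U *m U^t*).
apply: (le_indiameter (c := c) (strip _ _ SP) r0) => z /disc[v vv ->].
exists (U *m v); split; first exact: US.
  by rewrite cdot_isometry.
by rewrite -mulmxA (orthoproj_cdot _ SP).
Qed.

End EllipticalWidth.

(** * A disc in the numerical range of a 2 x 2 matrix *)

Section TwoByTwo.
Context {R : realType}.

(** For nonzero [w], [c] is a square root of [- conj w / |w|] and [r] is [|w|]. *)
Lemma exists_phase (w : R[i]) : exists c r,
  [/\ Num.conj c * c = 1, 0 <= r & c ^+ 2 * w = - r%:C].
Proof.
have [->|w0] := eqVneq w 0; first by exists 1, 0; rewrite mulr1 mulr0 oppr0 rmorph1.
have nw0 : `|w| != 0 by rewrite normr_eq0.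
pose u := - (Num.conj w / `|w|); pose c := sqrtC u.
have [r [r0 rE]] : exists r, 0 <= r /\ `|w| = r%:C.
  by exists (Num.sqrt (Re w ^+ 2 + Im w ^+ 2)); rewrite sqrtr_ge0 normc_def.
have nu : `|u| = 1 by rewrite normrN normf_div norm_conjC normr_id divff.
exists c, r; split=> //.
  by rewrite mulrC -normCK -normrX sqrtCK.
by rewrite sqrtCK -rE /u mulNr mulrAC (mulrC _ w) -normCK expr2 mulfK.
Qed.

(** Both sides are the discriminant of the characteristic polynomial; the traces show its invariance
    under unitary conjugation. *)
Lemma trace_sqr_2 (Z : 'M[R[i]]_2) :
  2 * \tr (Z *m Z) - \tr Z ^+ 2 = (Z 0 0 - Z 1 1) ^+ 2 + 4 * (Z 0 1 * Z 1 0).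
Proof.
rewrite /mxtrace !big_ord_recl !big_ord0 !addr0 !mxE !big_ord_recl !big_ord0 !addr0.
have -> : lift ord0 ord0 = 1 :> 'I_2 by apply: val_inj.
by move: (Z _ _) (Z _ _) (Z _ _) (Z _ _) => a b c d; ring.
Qed.

(** The phase is fixed first, through the discriminant, which gets multiplied by [c ^+ 2]; then [W]
    diagonalises the Hermitian part, as [Z 1 0 = - conj (Z 0 1)] records. The discriminant is twice
    the trace of [(H + iK)^2], so its value [- r] encodes [tr(HK) = 0] and [tr H^2 <= tr K^2]. *)
Lemma phase_diagonalise (Y : 'M[R[i]]_2) : exists c W r,
  let Z : 'M[R[i]]_2 := c *: (W^t* *m Y *m W) in
  [/\ Num.conj c * c = 1, W^t* *m W = 1%:M, Z 1 0 = - Num.conj (Z 0 1), 0 <= r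
    & (Z 0 0 - Z 1 1) ^+ 2 + 4 * (Z 0 1 * Z 1 0) = - r%:C].
Proof.
have [c [r [cc r0 cr]]] := exists_phase (2 * \tr (Y *m Y) - \tr Y ^+ 2).
pose H := c *: Y + (c *: Y)^t*.
have HH : H \is hermsymmx.
  apply/is_hermitianmxP; rewrite expr0 scale1r /H linearD /= map_mxD trmxCK.
  by rewrite addrC.
have [V [d [VV VH _]]] := hermitian_eigenbasis HH.
have VV' := mulmx1C VV.
exists c, (V^t*), r; move=> Z; have ZE : Z = V *m (c *: Y) *m V^t*.
  by rewrite /Z trmxCK -scalemxAr -scalemxAl.
split=> //; first by rewrite trmxCK.
  have : Z + Z^t* = diag_mx (\row_i (d i)%:C).
    rewrite ZE !trmxC_mul trmxCK mulmxA -mulmxDl -mulmxDr VH.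
    by rewrite -mulmxA VV' mulmx1.
  by move/matrixP/(_ 1 0); rewrite !mxE /= mulr0n => /eqP; rewrite addr_eq0 => /eqP.
have tr_conj (M : 'M[R[i]]_2) : \tr (V *m M *m V^t*) = \tr M.
  by rewrite mxtrace_mulC mulmxA VV mul1mx.
rewrite -trace_sqr_2 ZE tr_conj.
have -> : V *m (c *: Y) *m V^t* *m (V *m (c *: Y) *m V^t*)
          = V *m ((c *: Y) *m (c *: Y)) *m V^t*.
  by rewrite !mulmxA -[_ *m V^t* *m V]mulmxA VV mulmx1.
rewrite tr_conj -scalemxAl -scalemxAr scalerA !mxtraceZ -expr2 exprMn mulrCA -mulrBr.
by [].
Qed.

(** Here [x + it] is a point relative to the centre of the disc, and [N] stands for [|y|^2] with [y]
    an off-diagonal entry. The unknowns describe a unit vector [(p, conj y (q + is))]; the first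
    alternative is reached at [(0, 1)] instead. *)
Lemma disc_param_real (rho x t N : R) : rho != 0 -> rho ^+ 2 <= N ->
  x ^+ 2 + t ^+ 2 <= rho ^+ 2 ->
  (x = - rho /\ t = 0) \/
  exists p q s : R, [/\ p ^+ 2 + N * (q ^+ 2 + s ^+ 2) = 1,
    x = rho * (p ^+ 2 - N * (q ^+ 2 + s ^+ 2)) & t = 2 * (p * N * s)].
Proof.
move=> rho0 rhoN xt; have rho2 : 0 < rho ^+ 2 by rewrite exprn_even_gt0.
have N0 : 0 < N by apply: lt_le_trans rhoN.
(* The normalisation and the equation for [x] force this value of [p ^+ 2]. *)
pose P := (1 + x / rho) / 2.
have xE : x = rho * (2 * P - 1) by rewrite /P; field.
have cP : (1 - (2 * P - 1) ^+ 2) * rho ^+ 2 >= t ^+ 2.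
  by move: xt; rewrite xE exprMn; move: (rho ^+ 2) => *; lra.
have PP : 0 <= P * (1 - P).
  have : 0 <= (1 - (2 * P - 1) ^+ 2) * rho ^+ 2.
    by apply: le_trans cP; apply: sqr_ge0.
  by rewrite pmulr_lge0 //; lra.
have [P0|Pn0] := eqVneq P 0.
  left; move: cP; rewrite P0 mulr0 sub0r sqrrN expr1n subrr mul0r => t0.
  split; first by rewrite xE P0 mulr0 sub0r mulrN1.
  by apply/eqP; rewrite -sqrf_eq0 eq_le t0 sqr_ge0.
have Pgt : 0 < P by nra.
have Tge : 0 <= P * (1 - P) * N - t ^+ 2 / 4.
  have : P * (1 - P) * rho ^+ 2 <= P * (1 - P) * N by rewrite ler_wpM2l.
  by move: cP; move: (rho ^+ 2) (t ^+ 2) => *; nra.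
pose p := Num.sqrt P; have p2 : p ^+ 2 = P by rewrite sqr_sqrtr // ltW.
have p0 : p != 0 by rewrite gt_eqF // sqrtr_gt0.
have Nn0 : N != 0 by rewrite gt_eqF.
pose r := Num.sqrt (P * (1 - P) * N - t ^+ 2 / 4).
have r2 : r ^+ 2 = P * (1 - P) * N - t ^+ 2 / 4 by rewrite sqr_sqrtr.
(* The equation for [t] determines [s], and the normalisation then determines [q ^+ 2], which is
   nonnegative by [Tge], that is, thanks to [rho ^+ 2 <= N]. *)
right; exists p, (r / (p * N)), (t / (2 * p * N)).
have E : N * ((r / (p * N)) ^+ 2 + (t / (2 * p * N)) ^+ 2) = 1 - P.
  have -> : N * ((r / (p * N)) ^+ 2 + (t / (2 * p * N)) ^+ 2)
            = (r ^+ 2 + t ^+ 2 / 4) / (p ^+ 2 * N).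
    by field; rewrite ?p0 ?Nn0.
  by rewrite r2 p2; field; rewrite ?Pn0 ?Nn0.
rewrite E p2 xE; split; first by ring.
  by ring.
by field; rewrite ?p0 ?Nn0.
Qed.

(** The conclusion evaluates the form of [[z0, y; - conj y, z1]] at a unit vector. [rho] may be
    negative, hence the absolute value in the radius. *)
Lemma disc_param (z0 z1 y z : R[i]) (rho : R) :
  let m := (z0 + z1) / 2 in
  rho != 0 -> z0 - z1 = (2 * rho)%:C ->
  rho ^+ 2 <= Re y ^+ 2 + Im y ^+ 2 -> `|z - m| <= `|rho|%:C ->
  exists a b, Num.conj a * a + Num.conj b * b = 1 /\
    z = Num.conj a * (z0 * a + y * b) + Num.conj b * (- Num.conj y * a + z1 * b).
Proof.
move=> m rho0 z01 rhoy zm.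
pose x := Re (z - m); pose t := Im (z - m).
have xt : x ^+ 2 + t ^+ 2 <= rho ^+ 2.
  move: zm; rewrite normc_def lecR => zm.
  rewrite -[X in X <= _]sqr_sqrtr ?addr_ge0 ?sqr_ge0 //.
  by rewrite -[X in _ <= X]real_normK ?num_real // lerXn2r ?nnegrE ?sqrtr_ge0.
have z0E : z0 = m + rho%:C.
  have -> : rho%:C = (z0 - z1) / 2 by rewrite z01 rmorphM /= rmorph_nat; field.
  by rewrite /m; field.
have z1E : z1 = m - rho%:C.
  by rewrite -[z1](subKr z0) z01 z0E rmorphM /= rmorph_nat; ring.
have zE : z = m + (x +i* t).
  by rewrite addrC -[LHS](subrK m); congr (_ + _); apply: complex_ReIm.
have [[xr t0]|[p [q [s [e1 xE tE]]]]] := disc_param_real rho0 rhoy xt.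
  exists 0, 1; rewrite rmorph0 rmorph1 !mul0r !mulr0 !add0r !mulr1; split=> //.
  rewrite mul1r zE z1E xr t0; congr (_ + _).
  by apply: complex_ReIm; rewrite /= ?oppr0.
(* With the factor [conj y], the off-diagonal terms add up to [p * |y|^2 * (w - conj w)] for
   [w = q + is], which is purely imaginary. *)
exists p%:C, (Num.conj y * (q +i* s)).
have cp : Num.conj p%:C = p%:C by apply: complex_ReIm; rewrite ?ReImE //= oppr0.
have yy : Num.conj y * y = (Re y ^+ 2 + Im y ^+ 2)%:C := mulJ_normsq y.
have ww : Num.conj (q +i* s) * (q +i* s) = (q ^+ 2 + s ^+ 2)%:C := mulJ_normsq _.
have ws : (q +i* s) - Num.conj (q +i* s) = 0 +i* (2 * s).
  by apply: complex_ReIm; rewrite !ReImE /=; ring.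
rewrite cp rmorphM /= conjCK.
set N := Re y ^+ 2 + Im y ^+ 2 in e1 xE tE yy *.
move: ww ws; set w := q +i* s; move: (Num.conj w) (Num.conj y) yy => w' y' yy ww ws.
have bb : y * w' * (y' * w) = (N * (q ^+ 2 + s ^+ 2))%:C.
  by rewrite rmorphM /= -ww -yy; ring.
split.
  by rewrite bb -rmorphM -rmorphD /= -expr2 e1.
have -> : p%:C * (z0 * p%:C + y * (y' * w)) + y * w' * (- y' * p%:C + z1 * (y' * w))
  = z0 * (p ^+ 2)%:C + z1 * (y * w' * (y' * w)) + p%:C * (y' * y) * (w - w').
  by rewrite rmorphXn /=; ring.
rewrite bb ws yy zE z0E z1E xE tE.
set K := N * _ in e1 *.
have -> : (m + rho%:C) * (p ^+ 2)%:C + (m - rho%:C) * K%:C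
   = m * (p ^+ 2 + K)%:C + rho%:C * (p ^+ 2 - K)%:C.
  by rewrite rmorphD rmorphB /=; ring.
rewrite e1 mulr1 -addrA; congr (_ + _).
by apply: complex_ReIm; rewrite !ReImE /=; ring.
Qed.

End TwoByTwo.

(** * A strip no wider than the elliptical width *)

Section Strip.
Context {R : realType}.

Lemma cdot_mul_2 (Z : 'M[R[i]]_2) v : cdot v (Z *m v) =
  Num.conj (v 0 0) * (Z 0 0 * v 0 0 + Z 0 1 * v 1 0)
  + Num.conj (v 1 0) * (Z 1 0 * v 0 0 + Z 1 1 * v 1 0).
Proof.
rewrite cdotE !big_ord_recl !big_ord0 !addr0 !mxE !big_ord_recl !big_ord0 !addr0.
by have -> : lift ord0 ord0 = 1 :> 'I_2 by apply: val_inj.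
Qed.

Lemma normsq_2 (v : 'cV[R[i]]_2) :
  normsq v = Re (Num.conj (v 0 0) * v 0 0) + Re (Num.conj (v 1 0) * v 1 0).
Proof.
rewrite /normsq cdotE !big_ord_recl !big_ord0 addr0 cReD.
by have -> : lift ord0 ord0 = 1 :> 'I_2 by apply: val_inj.
Qed.

(** Gram-Schmidt yields two orthonormal rows even for dependent [h] and [k], as [1 < n] leaves room
    to complete them. *)
Lemma span2_isometry {n} (h k : 'cV[R[i]]_n) : (1 < n)%N ->
  exists2 U : 'M[R[i]]_(n, 2), U^t* *m U = 1%:M &
    forall s t, exists v, s *: h + t *: k = U *m v.
Proof.
move=> n1; pose A : 'M[R[i]]_(1 + 1, n) := col_mx h^T k^T.
have /unitarymxP BB := schmidt_unitarymx A n1.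
have /submxP[D AD] := schmidt_sub A.
exists (schmidt A)^T.
  apply: trmx_inj; rewrite trmx_mul trmxK trmx1 -[RHS]BB; congr (_ *m _).
  by apply/matrixP => i j; rewrite !mxE.
move=> s t; exists (row_mx s%:M t%:M *m D)^T.
rewrite -trmx_mul -mulmxA -AD mul_row_col !mul_scalar_mx.
by rewrite linearD !linearZ /= !trmxK.
Qed.

Lemma minmax_combination (p q x y : R) : 0 <= x -> 0 <= y ->
  Num.min p q * (x + y) <= p * x + q * y
  /\ p * x + q * y <= Num.max p q * (x + y).
Proof.
move=> x0 y0; rewrite !mulrDr.
by split; apply: lerD; apply: ler_wpM2r => //; rewrite ?ge_min ?le_max lexx ?orbT.
Qed.

Lemma compression_strip {n} (X : 'M[R[i]]_n) h k : (1 < n)%N ->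
  exists c a b, [/\ Num.conj c * c = 1, b - a <= elliptical_width X &
    forall s t, let w := s *: h + t *: k in
      a * normsq w <= Re (c * cdot w (X *m w))
      /\ Re (c * cdot w (X *m w)) <= b * normsq w].
Proof.
move=> n1; have [U0 UU0 spanU0] := span2_isometry h k n1.
have [c [W [r]]] := phase_diagonalise (U0^t* *m X *m U0).
pose U := U0 *m W.
have <- : U^t* *m X *m U = W^t* *m (U0^t* *m X *m U0) *m W.
  by rewrite /U trmxC_mul !mulmxA.
set Z := c *: _ => -[cc WW Z10 r0 disc].
have UU : U^t* *m U = 1%:M by rewrite trmxC_mul mulmxA -(mulmxA _ _ U0) UU0 mulmx1.
have qE v : c * cdot (U *m v) (X *m (U *m v)) = cdot v (Z *m v).
  by rewrite cdot_mull -scalemxAl cdotZr !mulmxA.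
pose p := Re (Z 0 0); pose q := Re (Z 1 1).
(* The off-diagonal terms contribute only to the imaginary part, by [Z10]. *)
have ReqE v : Re (cdot v (Z *m v))
    = p * Re (Num.conj (v 0 0) * v 0 0) + q * Re (Num.conj (v 1 0) * v 1 0).
  rewrite cdot_mul_2 Z10 /p /q.
  move: (Z 0 0) (Z 0 1) (Z 1 1) (v 0 0) (v 1 0) => a y b e f.
  rewrite !ReImE; move: (Re a) (Re y) (Re b) (Re e) (Re f) => *.
  by move: (Im a) (Im y) (Im b) (Im e) (Im f) => *; ring.
exists c, (Num.min p q), (Num.max p q); split=> //; last first.
  move=> s t w; have [v0 wE] := spanU0 s t.
  have -> : w = U *m (W^t* *m v0).
    by rewrite /w wE /U -mulmxA [W *m _]mulmxA (mulmx1C WW) mul1mx.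
  move: (W^t* *m v0) => v.
  rewrite qE ReqE /normsq (cdot_isometry _ _ UU) -/(normsq v).
  rewrite normsq_2 !mulJ_normsq /=.
  have x0 : 0 <= Re (v 0 0) ^+ 2 + Im (v 0 0) ^+ 2 by rewrite addr_ge0 ?sqr_ge0.
  have y0 : 0 <= Re (v 1 0) ^+ 2 + Im (v 1 0) ^+ 2 by rewrite addr_ge0 ?sqr_ge0.
  exact: minmax_combination.
(* Half the signed width of the strip; a disc of radius [|rho|] has to be found in the numerical
   range. *)
pose rho := (p - q) / 2.
have -> : Num.max p q - Num.min p q = 2 * `|rho|.
  have -> : p = q + 2 * rho by rewrite /rho; field.
  by case: (ger0P rho) => rho0; [rewrite max_l ?min_r|rewrite max_r ?min_l]; lra.
have [->|rho0] := eqVneq rho 0; first by rewrite normr0 mulr0 elliptical_width_ge0.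
have Re01 : Re (Z 0 0 - Z 1 1) = 2 * rho.
  by rewrite cReD cReN -/p -/q /rho; field.
have disc_re : (Z 0 0 - Z 1 1) ^+ 2
    = (4 * (Re (Z 0 1) ^+ 2 + Im (Z 0 1) ^+ 2) - r)%:C.
  rewrite rmorphB rmorphM rmorph_nat /= -mulJ_normsq -disc Z10; ring.
(* The square in [disc_re] is real and the real part [2 * rho] is nonzero, so the imaginary part
   vanishes. *)
have Im01 : Im (Z 0 0 - Z 1 1) = 0.
  have /(congr1 Im) := disc_re; rewrite expr2 cImM Re01 /= => /eqP.
  rewrite (mulrC (Im _)) -mulr2n -mulrnAr mulf_eq0 mulrn_eq0 /= mulf_eq0.
  by rewrite (negPf rho0) pnatr_eq0 /= => /eqP.
have Z01 : Z 0 0 - Z 1 1 = (2 * rho)%:C by apply: complex_ReIm.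
(* Real parts in [disc_re] give [4 * rho ^+ 2 = 4 * |Z 0 1|^2 - r]. *)
have rho_le : rho ^+ 2 <= Re (Z 0 1) ^+ 2 + Im (Z 0 1) ^+ 2.
  have /(congr1 Re) := disc_re; rewrite Z01 expr2 cReM /= mulr0 subr0.
  by move: (Re _ ^+ 2 + _) => N; nra.
have nc : `|c| = 1.
  by apply/eqP; rewrite -sqrp_eq1 // normCK mulrC cc.
(* The disc belongs to [c X]; multiplying by [conj c] rotates it back to [X]. *)
pose m := Num.conj c * ((Z 0 0 + Z 1 1) / 2).
apply: (le_elliptical_width (c := m) (ltnW n1) UU) => // z zle.
have zE : z = Num.conj c * (c * z) by rewrite mulrA cc mul1r.
have : `|c * z - (Z 0 0 + Z 1 1) / 2| <= `|rho|%:C.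
  apply: le_trans zle; rewrite {2}zE /m -mulrBr normrM norm_conjC nc mul1r.
  exact: lexx.
case/(disc_param rho0 Z01 rho_le) => a [b [ab czE]].
exists (\col_i [eta fun=> 0 with 0 |-> a, 1 |-> b] i).
  by rewrite cdotE !big_ord_recl !big_ord0 addr0 !mxE.
by rewrite zE czE -[RHS]mul1r -cc -mulrA qE cdot_mul_2 Z10 !mxE.
Qed.

End Strip.

(** * Dimension count and conclusion *)

Section Main.
Context {R : realType}.

Lemma cdot_mul_1 (X : 'M[R[i]]_1) (w : 'cV[R[i]]_1) :
  Re (cdot w (X *m w)) = Re (X 0 0) * normsq w.
Proof.
rewrite cdotE normsqE !big_ord1 !mxE big_ord1 mulrCA cReM mulJ_normsq /=.
by rewrite mulr0 subr0.
Qed.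

Lemma exists_test_vector {n} (A B X : 'M[R[i]]_n) (j : 'I_n) :
  let M := block_mx A X (X ^t*) B in
  M \is hermsymmx -> A + B \is hermsymmx ->
  exists h k, [/\ col_mx h k != 0,
    lambda (1 + 2 * j) M * normsq (col_mx h k) <= qform M (col_mx h k) &
    forall s t w, w = s *: h + t *: k ->
      qform (A + B) w <= lambda (1 + j) (A + B) * normsq w].
Proof.
move=> M HM HAB.
have jn : (2 * j < n + n)%N by rewrite addnn -mul2n ltn_mul2l ltn_ord.
have [V [_ [Q [_ Qcard _ MQ]]]] := hermitian_lambda HM jn.
have [W [P [_ [Pcard _ ABP _]]]] := hermitian_lambda HAB (ltn_ord j).
(* The forms under [Q] confine [z] to leading eigenvectors of [M]; the two copies of those under [P]
   make each half of [z] orthogonal to the eigenvectors of [A + B] with eigenvalue above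
   [lambda (1 + j) (A + B)]. *)
pose f (i : 'I_(n + n) + ('I_n + 'I_n)) : 'rV[R[i]]_(n + n) := match i with
  | inl i => row i V
  | inr (inl i) => row_mx (row i W) 0
  | inr (inr i) => row_mx 0 (row i W) end.
pose K (i : 'I_(n + n) + ('I_n + 'I_n)) := match i with
  | inl i => Q i | inr (inl i) => P i | inr (inr i) => P i end.
have [|z z0 zK] := exists_common_zero f (P := K).
  have -> : #|K| = (#|Q| + (#|P| + #|P|))%N.
    by rewrite -!sum1_card !big_sumType.
  (* At most [(2n - 2j - 1) + 2j] conditions on [2n] unknowns. *)
  have := leq_add Qcard (leq_add Pcard Pcard).
  move/leq_ltn_trans; apply.
  by rewrite (addnn j) -mul2n -[X in (_ < X)%N](subnK jn) ltn_add2l.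
exists (usubmx z), (dsubmx z); rewrite vsubmxK; split=> //.
  apply: MQ => i Qi; have := zK (inl i) Qi; rewrite /f -row_mul.
  by move/rowP/(_ 0); rewrite !mxE.
(* The conditions on [h] and [k] are linear and identical, so they pass to every combination. *)
move=> s t w ->; apply: ABP => i Pi; rewrite mulmxDr -!scalemxAr !mxE.
have := zK (inr (inl i)) Pi; have := zK (inr (inr i)) Pi.
rewrite /f -{1 2}[z]vsubmxK !mul_row_col !mul0mx add0r addr0 -!row_mul.
move=> /rowP/(_ 0) + /rowP/(_ 0); rewrite !mxE => -> ->.
by rewrite !mulr0 addr0.
Qed.

End Main.

Unset Implicit Arguments.
Set Strict Implicit.

Theorem theorem2p1 (R : realType) (n : nat) (n_gt0 : (0 < n)%N)
    (A B X : 'M[R[i]]_n)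
    (M_ge0 : possemidef (block_mx A X (X ^t*) B)) (j : 'I_n) :
  lambda (1 + 2 * j) (block_mx A X (X ^t*) B)
    <= lambda (1 + j) (A + B) + elliptical_width X.
Proof.
have HM := proj1 M_ge0.
have HAB : A + B \is hermsymmx.
  have := hermsymmxE HM; rewrite tr_block_mx map_block_mx => /eq_block_mx[AA _ _ BB].
  by apply/is_hermitianmxP; rewrite expr0 scale1r linearD /= map_mxD AA BB.
have [h [k [z0 Mz ABz]]] := exists_test_vector j HM HAB.
rewrite -(ler_pM2r (normsq_gt0 z0)); apply: le_trans Mz _.
suff [c [a [b [cc ab strip]]]] : exists c a b,
    [/\ Num.conj c * c = 1, b - a <= elliptical_width X &
    forall s t, let w := s *: h + t *: k in
      a * normsq w <= Re (c * cdot w (X *m w))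
      /\ Re (c * cdot w (X *m w)) <= b * normsq w].
  apply: le_trans (qform_block_le (a := a) (b := b) M_ge0 cc _) _.
    by move=> s t w; have [aw bw] := strip s t; split; [exact: (ABz s t)| |].
  by apply: ler_wpM2r; [exact: normsq_ge0|rewrite lerD2l].
have [n1|n1] := ltnP 1 n; first exact: compression_strip.
(* For [n = 1] there is no plane, but the form is a multiple of the squared norm, so a strip of
   width 0 with phase 1 suffices. *)
have n1E : n = 1%N by apply/eqP; rewrite eqn_leq n1.
subst n; exists 1, (Re (X 0 0)), (Re (X 0 0)).
rewrite subrr elliptical_width_ge0 rmorph1 mulr1; split=> // s t w.
by rewrite mul1r cdot_mul_1.
Qed.
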